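(* Let $p_1,\dots,p_k$ be distinct primes ($k\ge1$), and let $G=S_{p_1}\times\cdots\times S_{p_k}$, where $S_{p_i}=\mathbb{Z}_{p_i^{e_i}}\times\mathbb{Z}_{p_i^{t_i}}$ with $1\le t_i\le e_i$. An element $(a_1,a_2,\ldots,a_k)\in G$ is an isolated vertex of $\Gamma(G)$ if and only if $a_i\in\mathcal{I}(S_{p_i})$ for at least one $1\le i\le k$. Explicitly, $$\mathcal{I}(G)=\bigcup_{i=1}^{k}S_{p_1}\times\cdots\times\mathcal{I}(S_{p_i})\times\cdots\times S_{p_k}.$$
   Context: The generating graph $\Gamma(G)$ of a group $G$ is the simple graph with vertex set $G$ in which two distinct vertices $x,y$ are adjacent if and only if $\langle x,y\rangle=G$. $\mathcal{I}(G)$ is the set of isolated vertices of $\Gamma(G)$. In the $i$-th member of the union, the $i$-th factor $S_{p_i}$ is replaced by $\mathcal{I}(S_{p_i})$. *)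

(* Defs.v *)
From mathcomp Require Import all_boot all_fingroup zmodp.

Set Implicit Arguments.
Unset Strict Implicit.
Unset Printing Implicit Defensive.

(* A simple graph on a finite type is given by its adjacency relation. *)
Definition generating_graph (gT : finGroupType) : rel gT :=
  fun x y => (x != y) && (<<[set x; y]>>%g == [set: gT]).

Definition isolated_vertices (V : finType) (adj : rel V) : {set V} :=
  [set x | [forall y, ~~ adj x y]].

Definition isolated (gT : finGroupType) : {set gT} :=
  isolated_vertices (@generating_graph gT).

(* The group law on 'Z_n is addition modulo n. Since 'Z_n has n elements only  *)
(* for n > 1, Zpp p e t is as intended when p is prime and e, t > 0.           *)
Definition Zpp (p e t : nat) : finGroupType :=
  ('Z_(p ^ e) * 'Z_(p ^ t))%type.

(* The external direct product, with the componentwise law of gproduct. *)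
Definition Zpp_prod (k : nat) (p e t : 'I_k -> nat) : finGroupType :=
  {dffun forall i : 'I_k, Zpp (p i) (e i) (t i)}.

(* Main.v *)
(* In a noncyclic group the vertex [x] is isolated iff no [y] at all satisfies
   <x, y> = G, and both the factors and the product are noncyclic: the exponent
   p^e of Z_(p^e) x Z_(p^t) is smaller than its order.  Since the factors have
   pairwise coprime orders, a subgroup of the product that projects onto every
   factor has order divisible by the product of these orders, hence is the whole
   product; so (a, b) generates G iff each (a_i, b_i)
   generates S_(p_i); the generating partners b can be chosen componentwise. *)
Require Import Defs.
From mathcomp Require Import all_boot all_fingroup zmodp cyclic.

Set Implicit Arguments.
Unset Strict Implicit.
Unset Printing Implicit Defensive.

(** A partner [y] of [x] is automatically distinct from [x]: otherwise the whole group would be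
    [<[x]>], hence cyclic. *)
Lemma notin_isolatedP (gT : finGroupType) (x : gT) :
  ~~ cyclic [set: gT] ->
  reflect (exists y, <<[set x; y]>>%g = [set: gT]) (x \notin isolated gT).
Proof.
move=> ncG; rewrite inE negb_forall.
apply: (iffP existsP) => -[y]; first by case/negbNE/andP=> _ /eqP; exists y.
move=> genG; exists y; rewrite negbK /generating_graph genG eqxx andbT.
apply: contraNneq ncG => eq_xy.
by rewrite -genG eq_xy setUid cycle_cyclic.
Qed.

Lemma coprime_prodr (I : finType) (F : I -> nat) (m : nat) (r : seq I) :
  {in r, forall i, coprime m (F i)} -> coprime m (\prod_(i <- r) F i).
Proof.
move=> coF; rewrite big_seq; elim/big_ind: _ => //; first exact: coprimen1.
by move=> a b coa cob; rewrite coprimeMr coa.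
Qed.

Lemma prod_coprime_dvdn (I : finType) (F : I -> nat) (n : nat) :
  (forall i j, i != j -> coprime (F i) (F j)) -> (forall i, F i %| n) ->
  \prod_i F i %| n.
Proof.
move=> coF Fn; elim: (index_enum I) (index_enum_uniq I) => [|i r IHr] /=.
  by rewrite big_nil dvd1n.
case/andP=> ir uniq_r; rewrite big_cons Gauss_dvd ?Fn ?IHr //.
apply: coprime_prodr => j rj; apply: coF.
by apply: contraNneq ir => ->.
Qed.

Section DependentProduct.

Variables (I : finType) (gT : I -> finGroupType).
Local Notation gTn := {dffun forall i, gT i}.

Lemma setXnT : setXn (fun i => [set: gT i]) = [set: gTn].
Proof. by apply/setP=> x; rewrite in_setT; apply/setXnP=> i; rewrite in_setT. Qed.

Lemma morphim_dffunT i : (dffun_morphism gT i @* [set: gTn])%g = [set: gT i].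
Proof.
by have := morphim_dffunXn i (fun j => [set: gT j]); rewrite setXnT.
Qed.

Lemma morphim_dffun_gen2 i (a b : gTn) :
  (dffun_morphism gT i @* <<[set a; b]>>)%g = <<[set a i; b i]>>%g.
Proof.
by rewrite morphim_gen ?subsetT // morphimEsub ?subsetT // imsetU1 imset_set1.
Qed.

Lemma subdirect_coprime (H : {group gTn}) :
  (forall i j, i != j -> coprime #|gT i| #|gT j|) ->
  (forall i, (dffun_morphism gT i @* H)%g = [set: gT i]) ->
  H = [set: gTn] :> {set _}.
Proof.
move=> coT projH; apply/eqP; rewrite eqEcard subsetT /= -setXnT cardsXn.
under eq_bigr do rewrite cardsT.
rewrite dvdn_leq ?cardG_gt0 //; apply: prod_coprime_dvdn => // i.
(* Each factor is a homomorphic image of [H], so its order divides that of [H]. *)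
by rewrite -cardsT -projH dvdn_morphim.
Qed.

End DependentProduct.

Lemma Zp_expg_dvd m n (x : 'Z_m) : 1 < m -> m %| n -> (x ^+ n = 1)%g.
Proof.
move=> m_gt1 mn; apply/eqP; rewrite -order_dvdn (dvdn_trans _ mn) //.
rewrite -[m in _ %| m]Zp_cast // -[m in _ %| m]card_ord -cardsT.
by rewrite order_dvdG ?in_setT.
Qed.

Section Zpp.

Variables (p e t : nat).
Hypotheses (p_prime : prime p) (te : 0 < t <= e).

Let expp_gt1 n : 0 < n -> 1 < p ^ n.
Proof. by move=> n_gt0; rewrite -(exp1n n) ltn_exp2r ?prime_gt1. Qed.

Lemma card_Zpp : #|Zpp p e t| = p ^ (e + t).
Proof.
have [t_gt0 le_te] := andP te; have e_gt0 := leq_trans t_gt0 le_te.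
by rewrite card_prod !card_ord !Zp_cast ?expnD ?expp_gt1.
Qed.

Lemma Zpp_noncyclic : ~~ cyclic [set: Zpp p e t].
Proof.
have [t_gt0 le_te] := andP te; have e_gt0 := leq_trans t_gt0 le_te.
apply/cyclicP=> -[x Gx]; have: #[x]%g = p ^ (e + t).
  by rewrite /order -Gx cardsT card_Zpp.
(* The power [p ^ e] kills both coordinates, because [t <= e] gives [p ^ t %| p ^ e]. A generator
   has order [p ^ (e + t)], which cannot divide [p ^ e] as [t > 0]. *)
have : #[x]%g %| p ^ e.
  rewrite order_dvdn; apply/eqP.
  suff [fx sx]: ((x ^+ (p ^ e)).1 = 1 /\ (x ^+ (p ^ e)).2 = 1)%g.
    by rewrite [LHS]surjective_pairing fx sx.
  have := morphX (fst_morphism _ _) (p ^ e) (in_setT x).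
  have := morphX (snd_morphism _ _) (p ^ e) (in_setT x).
  by move=> /= -> ->; split; rewrite Zp_expg_dvd ?expp_gt1 ?dvdn_exp2l.
move=> xpe xq; move: xpe; rewrite xq dvdn_Pexp2l ?prime_gt1 //.
by rewrite -[X in _ <= X]addn0 leq_add2l leqNgt t_gt0.
Qed.

End Zpp.

Theorem proposition5p2 (k : nat) (k_gt0 : 0 < k) (p e t : 'I_k -> nat)
    (p_prime : forall i, prime (p i)) (p_inj : injective p)
    (te : forall i, 1 <= t i <= e i) :
  (forall a : {dffun forall i : 'I_k, Zpp (p i) (e i) (t i)},
     (a \in isolated (Zpp_prod p e t))
     <-> exists i : 'I_k, a i \in isolated (Zpp (p i) (e i) (t i)))
  /\ isolated (Zpp_prod p e t) =
     \bigcup_(i < k)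
       setXn (dfwith (fun j : 'I_k => [set: Zpp (p j) (e j) (t j)])
                     (isolated (Zpp (p i) (e i) (t i)))).
Proof.
pose S i := Zpp (p i) (e i) (t i).
have ncS i : ~~ cyclic [set: S i] by exact: Zpp_noncyclic.
have ncG : ~~ cyclic [set: Zpp_prod p e t].
  (* Since [0 < k] there is a factor with index 0; as an image of the product it would inherit
     cyclicity. *)
  apply: contra (ncS (Ordinal k_gt0)) => cycG.
  by rewrite -(morphim_dffunT S) morphim_cyclic.
have coS i j : i != j -> coprime #|S i| #|S j|.
  move=> neq_ij; rewrite !card_Zpp // coprimeXl // coprimeXr //.
  rewrite prime_coprime // dvdn_prime2 //.
  by apply: contraNneq neq_ij => /p_inj ->.
have isolatedE a : (a \in isolated (Zpp_prod p e t)) =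
    [exists i, a i \in isolated (S i)].
  (* Passing to complements turns isolation into the existence of a generating partner. *)
  apply: negb_inj; rewrite negb_exists.
  apply/idP/forallP => [/(notin_isolatedP _ ncG)[b genG] i|gen_a].
    apply/(notin_isolatedP _ (ncS i)); exists (b i).
    by rewrite -(morphim_dffun_gen2 (gT := S)) genG morphim_dffunT.
  have /fin_all_exists[b genS] i : exists y, <<[set a i; y]>>%g = [set: S i].
    exact: elimT (notin_isolatedP _ (ncS i)) (gen_a i).
  apply/(notin_isolatedP _ ncG).
  (* The chosen partners are assembled into one element; the [i]-th projection of the subgroup it
     generates with [a] is then all of [S i]. *)
  exists [ffun i => b i]; apply: (@subdirect_coprime _ S) => // i.
  rewrite morphim_dffun_gen2 ffunE; exact: genS.
split=> [a|]; first by rewrite isolatedE; split=> /existsP.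
apply/setP=> a; rewrite isolatedE; apply/existsP/bigcupP => -[i].
  move=> iso_ai; exists i => //; apply/setXnP=> j.
  (* Only the coordinate [j = i] is constrained; at every other [j] the factor is the full group. *)
  by have [<-|neq_ij] := eqVneq i j; rewrite ?dfwith_in ?dfwith_out ?in_setT.
by move=> _ /setXnP/(_ i); rewrite dfwith_in; exists i.
Qed.
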